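(* Let $n$ and $k$ be odd positive integers with $n\geq 3$, let $q=2^k$, and let $\mathcal{P}=\{\mathcal{B}_\alpha\mid \alpha\in\mathbb{F}_{q^n}^\times\}$, where the sets of lines $\mathcal{B}_\alpha$ of $\mathrm{PG}_n(q)$ are as defined in the context. Then $\mathcal{P}$ is a transitive $(q-1)$-fold packing of $\mathrm{PG}_n(q)$.
   Context: Setting: $\mathbb{F}_{q^n}^\times$ denotes the set (and multiplicative group) of non-zero elements of $\mathbb{F}_{q^n}$. Let $U=\mathbb{F}_{q^n}$, viewed as an $\mathbb{F}_q$-vector space of dimension $n$, let $W=\langle w\rangle\cong\mathbb{F}_q$ be a one-dimensional $\mathbb{F}_q$-space with $w\notin U$, and let $V=U\oplus W\cong\mathbb{F}_q^{n+1}$. The projective geometry $\mathrm{PG}_n(q)$ has underlying vector space $V$: its points are the 1-dimensional $\mathbb{F}_q$-subspaces of $V$ and its lines are the 2-dimensional $\mathbb{F}_q$-subspaces of $V$; a basis for a line is an (ordered) $\mathbb{F}_q$-basis of the corresponding 2-dimensional subspace. For $\alpha\in\mathbb{F}_{q^n}^\times$, $\mathcal{B}_\alpha$ is the set of all lines $\ell$ of $\mathrm{PG}_n(q)$ for which there exists a basis $x+x_0w,\ y+y_0w$ for $\ell$, with $x,y\in\mathbb{F}_{q^n}^\times$ and $x_0,y_0\in\mathbb{F}_q$, such that $$\begin{vmatrix} x & x^q\\ y & y^q\end{vmatrix}+\begin{vmatrix} x & x_0\\ y & y_0\end{vmatrix}^{q+1}=\alpha,$$ where vertical bars denote determinants (computed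 in $\mathbb{F}_{q^n}$). Definitions: A spread of $\mathrm{PG}_n(q)$ is a set of lines inducing a partition of the point set (every point lies on exactly one line of the set). A $t$-fold packing of $\mathrm{PG}_n(q)$ is a collection $\mathcal{P}$ of spreads of $\mathrm{PG}_n(q)$ such that every line of $\mathrm{PG}_n(q)$ is contained in precisely $t$ elements of $\mathcal{P}$. A $t$-fold packing $\mathcal{P}$ is transitive if there exists a subgroup of $\mathrm{P\Gamma L}_{n+1}(q)$ (acting on lines, and hence on sets of lines) leaving $\mathcal{P}$ invariant and acting transitively on the spreads of $\mathcal{P}$. *)

(* Defs.v *)
From HB Require Import structures.
From mathcomp Require Import all_boot all_order all_algebra.
From mathcomp Require Import all_fingroup all_solvable all_field.

Set Implicit Arguments.
Unset Strict Implicit.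
Unset Printing Implicit Defensive.

Import GroupScope GRing.Theory.
Local Open Scope ring_scope.

HB.instance Definition _ (F : finFieldType) (V : vectType F) :
  isCountable {vspace V} :=
  CanIsCountable (@VectorInternalTheory.vs2mxK F V).
HB.instance Definition _ (F : finFieldType) (V : vectType F) :
  isFinite {vspace V} := CanIsFinite (@VectorInternalTheory.vs2mxK F V).

(* PG(V): the subspaces of a vector space V over a finite field F.  The type  *)
(* finvect_type V is V itself, with its finType structure.                    *)
Section ProjectiveGeometry.
Variables (F : finFieldType) (V : vectType F).
Local Notation fV := (finvect_type V).

Definition points : {set {vspace V}} := [set p | \dim p == 1%N].
Definition lines : {set {vspace V}} := [set l | \dim l == 2%N].

Definition is_spread (S : {set {vspace V}}) : Prop :=
  S \subset lines /\
  forall p, p \in points -> #|[set l in S | (p <= l)%VS]| = 1%N.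

Definition is_packing (t : nat) (P : {set {set {vspace V}}}) : Prop :=
  (forall S, S \in P -> is_spread S) /\
  forall l, l \in lines -> #|[set S in P | l \in S]| = t.

Definition field_auto (s : {perm F}) : bool :=
  [&& s 1 == 1, [forall a, forall b, s (a + b) == s a + s b]
    & [forall a, forall b, s (a * b) == s a * s b]].

Definition semilinear_for (s : {perm F}) (f : {perm fV}) : bool :=
  [forall u, forall v, f (u + v) == f u + f v] &&
  [forall a : F, forall v, f (a *: v) == s a *: f v].

Definition GammaL : {set {perm fV}} :=
  [set f | [exists s, field_auto s && semilinear_for s f]].

Definition scalars : {set {perm fV}} :=
  [set f : {perm fV} | [exists c : F, (c != 0) && [forall v, f v == c *: v]]].

Lemma field_autoP (s : {perm F}) :
  reflect [/\ s 1 = 1, {morph s : a b / a + b} & {morph s : a b / a * b}]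
          (field_auto s).
Proof.
apply: (iffP and3P) => [[/eqP s1 /forallP sD /forallP sM]|[s1 sD sM]].
  by split=> // a b; apply/eqP; [exact: (forallP (sD a)) | exact: (forallP (sM a))].
by split; [apply/eqP | apply/forallP=> a; apply/forallP=> b; rewrite sD
  | apply/forallP=> a; apply/forallP=> b; rewrite sM].
Qed.

Lemma semilinear_forP (s : {perm F}) (f : {perm fV}) :
  reflect ({morph f : u v / u + v} /\ forall (a : F) v, f (a *: v) = s a *: f v)
          (semilinear_for s f).
Proof.
apply: (iffP andP) => [[/forallP fD /forallP fZ]|[fD fZ]].
  by split=> u v; apply/eqP; [exact: (forallP (fD u)) | exact: (forallP (fZ u))].
by split; apply/forallP=> u; apply/forallP=> v; rewrite ?fD ?fZ.
Qed.

Lemma GammaL_group_set : group_set GammaL.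
Proof.
apply/group_setP; split=> [|f g].
  rewrite inE; apply/existsP; exists 1%g; apply/andP; split.
    by apply/field_autoP; split=> [|a b|a b]; rewrite !perm1.
  by apply/semilinear_forP; split=> [u v|a v]; rewrite !perm1.
rewrite !inE => /existsP[s /andP[/field_autoP[s1 sD sM] /semilinear_forP[fD fZ]]].
case/existsP=> t /andP[/field_autoP[t1 tD tM] /semilinear_forP[gD gZ]].
apply/existsP; exists (s * t)%g; apply/andP; split.
  by apply/field_autoP; split=> [|a b|a b]; rewrite !permM ?s1 ?sD ?sM.
by apply/semilinear_forP; split=> [u v|a v]; rewrite !permM ?fD ?fZ ?gD ?gZ.
Qed.
Canonical GammaL_group := Group GammaL_group_set.

Lemma scalars_group_set : group_set scalars.
Proof.
apply/group_setP; split=> [|f g].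
  rewrite inE; apply/existsP; exists 1; rewrite oner_neq0.
  by apply/forallP=> v; rewrite perm1 scale1r.
rewrite !inE => /existsP[c /andP[c0 /forallP fc]] /existsP[d /andP[d0 /forallP gd]].
apply/existsP; exists (d * c); rewrite mulf_neq0 //=; apply/forallP=> v.
by rewrite permM (eqP (gd _)) (eqP (fc _)) scalerA.
Qed.
Canonical scalars_group := Group scalars_group_set.

Lemma scalars_normal : scalars <| GammaL.
Proof.
apply/andP; split.
  apply/subsetP=> f; rewrite !inE => /existsP[c /andP[c0 /forallP fc]].
  apply/existsP; exists 1%g; apply/andP; split.
    by apply/field_autoP; split=> [|a b|a b]; rewrite !perm1.
  apply/semilinear_forP; split=> [u v|a v]; rewrite !(eqP (fc _)) ?scalerDr //.
  by rewrite perm1 !scalerA mulrC.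
apply/subsetP=> f; rewrite !inE.
case/existsP=> s /andP[/field_autoP[s1 sD sM] /semilinear_forP[fD fZ]].
apply/subsetP=> h /imsetP[g]; rewrite !inE => /existsP[c /andP[c0 /forallP gc]] ->.
apply/existsP; exists (s c); apply/andP; split.
  have s0: s 0 = 0 by apply: (addrI (s 0)); rewrite -sD !addr0.
  by rewrite -s0 (inj_eq perm_inj).
by apply/forallP=> v; rewrite conjgE !permM (eqP (gc _)) fZ permKV.
Qed.

Definition PGammaL : {set coset_of scalars} := (GammaL / scalars)%g.

(* Image of a subspace.  Totalised by the identity outside GammaL, because    *)
(* an action in MathComp must be injective for every group element.           *)
Definition vsact (U : {vspace V}) (f : {perm fV}) : {vspace V} :=
  if f \in GammaL then <<[seq (f u : V) | u : fV in U]>>%VS else U.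

Lemma memv_vsact (U : {vspace V}) (f : {perm fV}) (v : fV) :
  f \in GammaL -> ((f v : V) \in vsact U f) = (v \in U).
Proof.
move=> Gf; rewrite /vsact Gf; move: Gf; rewrite inE.
case/existsP=> s /andP[/field_autoP[s1 sD sM] /semilinear_forP[fD fZ]].
apply/idP/idP=> [|Uv]; last by apply: memv_span; apply: image_f.
have f0: f 0 = 0 by apply: (addrI (f 0)); rewrite -fD !addr0.
set X := image _ _ => fvX.
suff [u Uu /perm_inj-> //]: exists2 u : fV, u \in U & f v = f u.
rewrite (coord_span (X := in_tuple X) fvX); elim/big_ind: _ => [|x y|i _].
- by exists 0; [exact: mem0v | exact: esym f0].
- by move=> [u Uu ->] [w Uw ->]; exists (u + w); [exact: memvD | exact: esym (fD u w)].
have /imageP[u Uu ->]: X`_i \in X by apply: mem_nth.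
set a := coord _ _ _; exists (s^-1%g a *: u); first exact: memvZ.
by rewrite fZ permKV.
Qed.

Lemma vsact_is_action : is_action GammaL vsact.
Proof.
split=> [f U W|U f g Gf Gg].
  have [Gf eUW|nGf] := boolP (f \in GammaL); last by rewrite /vsact (negPf nGf).
  by apply/vspaceP=> v; rewrite -(memv_vsact U v Gf) eUW memv_vsact.
apply/vspaceP=> v; rewrite -[v](permKV (f * g)%g).
rewrite memv_vsact ?groupM //; set u := _ v.
by rewrite permM !memv_vsact.
Qed.
Canonical vsact_action := Action vsact_is_action.

Definition pgact : action PGammaL {vspace V} := (vsact_action %% scalars)%act.

(* The restriction to fixed points of scalars built into %% is vacuous here.  *)
Lemma pgactE (U : {vspace V}) (f : {perm fV}) :
  f \in GammaL -> pgact U (coset scalars f) = vsact U f.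
Proof.
move=> Gf; have [sZG nZG] := andP scalars_normal.
apply: modactE => //; first exact: (subsetP nZG).
apply/afixP=> g /setIP[Gg]; rewrite inE => /existsP[c /andP[c0 /forallP gc]].
apply/vspaceP=> v; rewrite -[v in LHS](permKV g) memv_vsact //.
set u := _ v; have ->: v = c *: (u : V) by rewrite -[LHS](permKV g); exact/eqP/gc.
by apply/idP/idP=> [|/(memvZ c^-1)]; [exact: memvZ | rewrite scalerA mulVf ?scale1r].
Qed.

Definition is_transitive_packing (t : nat) (P : {set {set {vspace V}}}) : Prop :=
  is_packing t P /\
  exists G : {group coset_of scalars},
    [/\ G \subset PGammaL, [acts G, on P | pgact^*]
      & [transitive G, on P | pgact^*]].

End ProjectiveGeometry.

Section Packing.
Variables (F : finFieldType) (L : fieldExtType F).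

(* V = U + <w> with U = L: the pair (x, x0) is x + x0 w.                      *)
Definition ambient : vectType F := (L * F^o)%type.

Definition mx2 (a b c d : L) : 'M[L]_2 :=
  \matrix_(i < 2, j < 2)
    if i == 0 then (if j == 0 then a else b) else (if j == 0 then c else d).

Definition line_set (alpha : L) : {set {vspace ambient}} :=
  [set l in lines ambient |
    [exists x : finvect_type L, exists y : finvect_type L,
     exists x0 : F, exists y0 : F,
     [&& x != 0, y != 0, basis_of l [:: (x, x0) : ambient; (y, y0) : ambient]
       & \det (mx2 x (x ^+ #|F|) y (y ^+ #|F|))
         + \det (mx2 x x0%:A y y0%:A) ^+ #|F|.+1 == alpha]]].

Definition line_set_family : {set {set {vspace ambient}}} :=
  [set line_set alpha | alpha : finvect_type L & alpha != 0].

End Packing.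

(* Main.v *)
From HB Require Import structures.
Require Import Defs.
From mathcomp Require Import all_boot all_order all_algebra.
From mathcomp Require Import all_fingroup all_solvable all_field.
From mathcomp Require Import ring.

Set Implicit Arguments.
Unset Strict Implicit.
Unset Printing Implicit Defensive.

Import GRing.Theory.
Local Open Scope ring_scope.

(* A change of basis of determinant d turns the left-hand side W + M^(q+1) of *)
(* the defining equation into d W + d^2 M^(q+1).  Hence, for a nonzero vector *)
(* u, the lines of B_alpha through <u> are the <u, v> with form u v = alpha.  *)
(* If u = x is in L, then v = x t + c w gives x^(q+1) (t^q - t + c^2); since  *)
(* n is odd and q even, L is the direct sum of F and the image of t^q - t, so *)
(* alpha determines c, and t modulo F.  If u = x + w, one may take v = y in   *)
(* L, and the form is (x + y)^(q+1) - x^(q+1), where z^(q+1) is bijective on  *)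
(* L; so every B_alpha is a spread.  A line lies in the B_alpha with alpha =  *)
(* d W + d^2 M^(q+1), and these q - 1 values are distinct by the same direct  *)
(* sum.  Finally x + c w |-> lam x + c w maps B_alpha to                      *)
(* B_(lam^(q+1) alpha), and lam^(q+1) takes every value.                      *)

(** Two facts about L, for q even and n odd, carry the proof. The additive one is that L is the
    direct sum of F and the image of t^q - t ([artin_schreier_base], [artin_schreier_onto]); it
    governs points of U. The multiplicative one is that x^(q+1) permutes L ([norm_inj],
    [norm_surj]); it governs points off U. Together they give, for nonzero u and alpha, a vector v
    with [form u v = alpha] ([form_complete]), unique up to the line it spans with u
    ([form_complete_unique]); hence the spreads. For the packing, the form takes distinct values on
    the multiples of v ([form_scale_inj]), and distinct alpha give distinct B_alpha
    ([line_set_inj]). Transitivity comes from multiplication by lam on U ([homothety_line_set]). *)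

Section Span2.
Variables (K : fieldType) (V : vectType K).
Implicit Types (a b c d : K).
Implicit Types (u v w : V) (l : {vspace V}).

Lemma span2P w u v :
  reflect (exists a b, w = a *: u + b *: v) (w \in <<[:: u; v]>>%VS).
Proof.
rewrite span_cons span_seq1; apply: (iffP memv_addP) => [[_ /vlineP[a ->]]|[a [b ->]]].
  by case=> _ /vlineP[b ->] ->; exists a, b.
exists (a *: u); first by apply/vlineP; exists a.
by exists (b *: v) => //; apply/vlineP; exists b.
Qed.

Lemma free2P u v :
  u != 0 -> reflect (exists c, v = c *: u) (~~ free [:: u; v]).
Proof.
move=> u0; rewrite (perm_free (_ : perm_eq _ [:: v; u])); last first.
  exact: (permEl (perm_catC [:: u] [:: v])).
by rewrite free_cons seq1_free u0 andbT negbK span_seq1; exact: vlineP.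
Qed.

Lemma eq_span2 l u v :
  \dim l = 2%N -> u \in l -> v \in l -> free [:: u; v] -> l = <<[:: u; v]>>%VS.
Proof.
move=> dl lu lv fr; apply/esym/eqP; rewrite eqEdim dl (eqnP fr) leqnn andbT.
by apply/span_subvP=> w; rewrite !inE => /orP[]/eqP->.
Qed.

Lemma line_through l u :
  \dim l = 2%N -> u \in l -> u != 0 ->
  exists v, free [:: u; v] /\ l = <<[:: u; v]>>%VS.
Proof.
move=> dl lu u0; have /subvPn[v lv uv]: ~~ (l <= <[u]>)%VS.
  by apply/negP=> /dimvS; rewrite dl dim_vline u0.
have fr: free [:: u; v].
  by apply: contraNT uv => /(free2P _ u0)[c ->]; apply/vlineP; exists c.
by exists v; split=> //; exact: eq_span2.
Qed.

Lemma span2_addl a u v : <<[:: (u + a *: v)%R; v]>>%VS = <<[:: u; v]>>%VS.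
Proof.
apply/vspaceP=> w; apply/span2P/span2P=> -[b [c ->]].
  by exists b, (b * a + c); rewrite scalerDr scalerA scalerDl addrA.
exists b, (c - b * a); rewrite scalerDr scalerA scalerBl -!addrA; congr (_ + _).
by rewrite addrC subrK.
Qed.

Lemma span2_addr a u v : <<[:: u; (a *: u + v)%R]>>%VS = <<[:: u; v]>>%VS.
Proof.
apply/vspaceP=> w; apply/span2P/span2P=> -[b [c ->]].
  by exists (b + c * a), c; rewrite scalerDr scalerA scalerDl addrA.
by exists (b - c * a), c; rewrite scalerDr scalerA scalerBl addrA subrK.
Qed.

Lemma span2_det1 a b c d u v :
  a * d - b * c = 1 ->
  <<[:: (a *: u + b *: v)%R; (c *: u + d *: v)%R]>>%VS = <<[:: u; v]>>%VS.
Proof.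
move=> e1; apply/vspaceP=> w; apply/span2P/span2P=> -[g [h ->]].
  exists (g * a + h * c), (g * b + h * d).
  by rewrite !scalerDr !scalerA !scalerDl addrACA.
(* The inverse of the change of basis has rows (d, -b) and (-c, a), its determinant being 1. *)
exists (g * d - h * c), (h * a - g * b).
rewrite !scalerDr !scalerA addrACA -!scalerDl; congr (_ *: _ + _ *: _).
  by rewrite -[LHS]mulr1 -e1; ring.
by rewrite -[LHS]mulr1 -e1; ring.
Qed.

End Span2.

(** * The form that defines B_alpha *)

Section Form.
Variables (F : finFieldType) (L : fieldExtType F).
Local Notation q := #|F|.
Local Notation V := (ambient L).
Implicit Types (x y z t : L) (a b c d : F) (u v w : V) (l : {vspace V}).

Lemma frobD x y : (x + y) ^+ q = x ^+ q + y ^+ q.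
Proof.
have [p p_pr pcharFp] := finPcharP F.
apply: exprDn_pchar; rewrite (eq_pnat _ (pchar_lalg L)) (eq_pnat _ (pcharf_eq pcharFp)).
by rewrite (card_pprimeChar pcharFp) pnatX pnat_id.
Qed.

Lemma frobA c : c%:A ^+ q = c%:A :> L.
Proof. by rewrite -in_algE -rmorphXn /= expf_card. Qed.

Lemma frobZ c x : (c *: x) ^+ q = c *: x ^+ q.
Proof. by rewrite -[in LHS]mulr_algl exprMn frobA mulr_algl. Qed.

Lemma frobN x : (- x) ^+ q = - x ^+ q.
Proof.
apply/eqP; rewrite -subr_eq0 opprK -frobD addNr expr0n.
by rewrite (gtn_eqF (ltnW (finNzRing_gt1 F))).
Qed.

Definition frobE := (frobN, frobD, exprMn, frobA).

Lemma frob_fix x : x ^+ q = x -> exists c, x = c%:A.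
Proof.
move=> xq; apply/vlineP; have := Fermat's_little_theorem 1%AS x.
by rewrite dimv1 expn1 xq eqxx.
Qed.

Lemma frob_iter_dim x : x ^+ (q ^ \dim {:L})%N = x.
Proof. by apply/eqP; rewrite -(Fermat's_little_theorem {:L}%AS) memvf. Qed.

(** The 2 by 2 Moore determinant of the U-components. *)
Definition wronskian u v : L := u.1 * v.1 ^+ q - u.1 ^+ q * v.1.
Definition minor u v : L := u.1 * v.2%:A - u.2%:A * v.1.
Definition form u v : L := wronskian u v + minor u v ^+ q.+1.

Lemma scale_in_alg c x : c *: x = in_alg L c * x.
Proof. by rewrite mulr_algl. Qed.

Lemma frob_in_alg c : in_alg L c ^+ q = in_alg L c.
Proof. by rewrite -rmorphXn expf_card. Qed.

(** Both determinants are alternating and F-bilinear, so a change of basis multiplies each by its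
    determinant d; the power q + 1 then contributes d^2, since d^q = d. *)
Lemma form_lin a b c d u v :
  form (a *: u + b *: v) (c *: u + d *: v) =
    (a * d - b * c)%:A * wronskian u v + (a * d - b * c)%:A ^+ 2 * minor u v ^+ q.+1.
Proof.
case: u v => [x x0] [y y0]; rewrite /form /wronskian /minor /=.
rewrite !scale_in_alg !mulr1 ![_ *: (_ : F^o)]mulrC.
rewrite !exprS !(frobE, rmorphD, rmorphN, rmorphM, frob_in_alg) /=.
(* Once Frobenius is expanded, x and x^q can be treated as independent variables. *)
move: (in_alg L a) (in_alg L b) (in_alg L c) (in_alg L d).
move: (in_alg L x0) (in_alg L y0) (x ^+ q) (y ^+ q).
by move=> *; ring.
Qed.

Lemma form_scale a u v :
  form u (a *: v) = a%:A * wronskian u v + a%:A ^+ 2 * minor u v ^+ q.+1.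
Proof.
by have := form_lin 1 0 0 a u v; rewrite !scale1r !scale0r addr0 add0r mul1r mul0r subr0.
Qed.

Lemma form_det1 a b c d u v :
  a * d - b * c = 1 -> form (a *: u + b *: v) (c *: u + d *: v) = form u v.
Proof. by move=> e1; rewrite form_lin e1 scale1r expr1n !mul1r. Qed.

Lemma form_det0 a b c d u v :
  a * d - b * c = 0 -> form (a *: u + b *: v) (c *: u + d *: v) = 0.
Proof. by move=> e0; rewrite form_lin e0 scale0r expr0n !mul0r addr0. Qed.

Lemma form_addl a u v : form (u + a *: v) v = form u v.
Proof.
have := @form_det1 1 a 0 1 u v.
by rewrite !scale1r scale0r add0r; apply; rewrite mul1r mulr0 subr0.
Qed.

Lemma form_addr a u v : form u (a *: u + v) = form u v.
Proof.
have := @form_det1 1 0 a 1 u v.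
by rewrite !scale1r scale0r addr0; apply; rewrite mul1r mul0r subr0.
Qed.

Lemma form_neq0_left u v : form u v != 0 -> u != 0.
Proof.
apply: contraNneq => ->; have := @form_det0 0 0 0 1 0 v.
by rewrite !scale0r scale1r !add0r => ->; rewrite // !mul0r subr0.
Qed.

Lemma form_free u v : form u v != 0 -> free [:: u; v].
Proof.
move=> f0; have u0 := form_neq0_left f0.
apply: contraNT f0 => /(free2P _ u0)[c ->].
have := @form_det0 1 0 c 0 u 0; rewrite !scale0r !addr0 scale1r => -> //.
by rewrite mul1r mul0r subr0.
Qed.

Lemma dim_form u v : form u v != 0 -> \dim <<[:: u; v]>> = 2%N.
Proof. by move=> /form_free/eqnP->. Qed.

Lemma det_mx2 (x y z t : L) : \det (mx2 x y z t) = x * t - y * z.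
Proof.
rewrite (expand_det_row _ 0) !big_ord_recl big_ord0 /cofactor !det_mx11 !mxE /=.
by rewrite expr0 expr1 mul1r mulN1r mulrN addr0.
Qed.

(** The condition that x and y be nonzero costs nothing: the form vanishes if both U-components do,
    and otherwise adding one vector to the other, a change of determinant 1, makes both nonzero. *)
Lemma line_setP alpha l : alpha != 0 ->
  reflect (exists u v, l = <<[:: u; v]>>%VS /\ form u v = alpha) (l \in line_set alpha).
Proof.
move=> alpha0; rewrite inE; apply: (iffP andP) => [[_]|[u [v [-> fuv]]]].
  case/existsP=> x /existsP[y] /existsP[x0] /existsP[y0].
  case/and4P=> _ _ /span_basis <- /eqP<-.
  by exists (x, x0), (y, y0); rewrite !det_mx2.
split; first by rewrite inE dim_form ?fuv.
wlog [u1 v1]: u v fuv / u.1 != 0 /\ v.1 != 0; last first.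
  case: u v fuv u1 v1 => [x x0] [y y0] /= fuv u1 v1.
  apply/existsP; exists x; apply/existsP; exists y; apply/existsP; exists x0.
  apply/existsP; exists y0; rewrite u1 v1 /= !det_mx2; apply/andP; split.
    by rewrite /basis_of eqxx form_free ?fuv.
  exact/eqP.
move=> IH; case: (eqVneq u.1 0) => u1; last first.
  case: (eqVneq v.1 0) => v1; last exact: IH.
  rewrite -(span2_addr 1); apply: IH; rewrite ?form_addr //.
  by rewrite /= v1 addr0 scale1r.
rewrite -(span2_addl 1); apply: IH; rewrite ?form_addl //= u1 add0r scale1r.
suff: v.1 != 0 by [].
move: alpha0; rewrite -fuv; apply: contraNneq => v1.
rewrite /form /wronskian /minor u1 v1 !mul0r !mulr0 !subrr add0r.
by rewrite expr0n.
Qed.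

(** The coordinates (a, b) of u are the first row of a matrix of determinant 1, and such a change of
    basis preserves the form. *)
Lemma line_set_through alpha l u :
  alpha != 0 -> u != 0 -> l \in line_set alpha -> u \in l ->
  exists v, l = <<[:: u; v]>>%VS /\ form u v = alpha.
Proof.
move=> alpha0 u0 /(line_setP _ alpha0)[x [y [-> fxy]]] /span2P[a [b defu]].
have [a0|a0] := eqVneq a 0; last first.
  exists (0 *: x + a^-1 *: y); rewrite defu.
  by rewrite span2_det1 ?form_det1 // mulfV // mulr0 subr0.
have b0: b != 0 by apply: contraNneq u0 => b0; rewrite defu a0 b0 !scale0r addr0.
exists (- b^-1 *: x + 0 *: y); rewrite defu.
by rewrite span2_det1 ?form_det1 // mulr0 mulrN mulfV // opprK add0r.
Qed.

(** A shear removes the u-component of the second basis vector, so only the scale d of v matters. *)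
Lemma mem_line_set_span alpha u v : alpha != 0 -> free [:: u; v] ->
  (<<[:: u; v]>>%VS \in line_set alpha) -> exists2 d, d != 0 & form u (d *: v) = alpha.
Proof.
move=> alpha0 fr luv.
have u0 : u != 0 by apply: contraTneq fr => ->; rewrite free_cons mem0v.
have [] := line_set_through alpha0 u0 luv; first by rewrite memv_span ?mem_head.
move=> w [defl fuw]; have /span2P[a [d defw]]: w \in <<[:: u; v]>>%VS.
  by rewrite defl memv_span // !inE eqxx orbT.
move: fuw; rewrite defw form_addr => fuw; exists d => //.
by apply: contraNneq alpha0 => d0; rewrite -fuw d0 form_scale scale0r expr0n !mul0r addr0.
Qed.

Lemma span_mem_line_set alpha d u v : alpha != 0 -> d != 0 -> form u (d *: v) = alpha ->
  <<[:: u; v]>>%VS \in line_set alpha.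
Proof.
move=> alpha0 d0 fuv; apply/(line_setP _ alpha0); exists u, (d *: v); split=> //.
apply/vspaceP=> w; apply/span2P/span2P=> -[g [h ->]].
  by exists g, (h / d); rewrite scalerA divfK.
by exists g, (h * d); rewrite scalerA.
Qed.

End Form.

(** * Even q and odd n: the spreads, and the number of them through a line *)

Lemma sqr_inj_pchar2 (K : fieldType) :
  2%N \in [pchar K] -> injective (fun a : K => a ^+ 2).
Proof.
move=> pcharK2 a b /eqP /=; rewrite eqf_sqr (oppr_pchar2 pcharK2) orbb.
by move/eqP.
Qed.

Section LineSets.
Variables (F : finFieldType) (L : fieldExtType F).
Hypotheses (pcharF2 : 2%N \in [pchar F]) (odd_dimL : odd (\dim {:L})).
Local Notation q := #|F|.
Local Notation V := (ambient L).
Implicit Types (x y z t alpha beta : L) (a b c d e : F) (u v w : V).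
Implicit Types l : {vspace V}.

Let pcharL2 : 2%N \in [pchar L].
Proof. by rewrite pchar_lalg. Qed.

(** Applying Frobenius n times gives z = z + n c, and n c = c since n is odd and the characteristic
    is 2. *)
Lemma artin_schreier_base z c : z ^+ q - z = c%:A -> c = 0.
Proof.
move/(canRL (subrK _)) => zq.
have frob_iter i : z ^+ (q ^ i)%N = z + (c *+ i)%:A.
  elim: i => [|i IH]; first by rewrite expr1 mulr0n scale0r addr0.
  by rewrite expnSr exprM IH !frobE zq mulrS scalerDl addrAC addrC addrA.
have := frob_iter (\dim {:L}); rewrite frob_iter_dim -{1}[z]addr0 => /addrI/esym/eqP.
rewrite scaler_eq0 oner_eq0 orbF -[\dim _]odd_double_half odd_dimL mulrnDr mulr1n.
by rewrite -mul2n mulrnA (mulrn_pchar pcharF2) mul0rn addr0 => /eqP.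
Qed.

Lemma artin_schreier_const z c : z ^+ q - z = c%:A -> exists a, z = a%:A.
Proof.
move=> zc; apply: frob_fix; apply/eqP.
by rewrite -subr_eq0 zc (artin_schreier_base zc) scale0r.
Qed.

(** If r^(q+1) = 1 then Frobenius inverts r; its n-th iterate is the identity, so r = r^-1 as n is
    odd, and r = 1 in characteristic 2. *)
Lemma norm_inj : injective (fun x => x ^+ q.+1).
Proof.
move=> x y /= xy; have [y0|y0] := eqVneq y 0.
  by move/eqP: xy; rewrite y0 expr0n expf_eq0 => /eqP.
suff /eqP: (x / y) ^+ 2 = 1.
  rewrite sqrf_eq1 (oppr_pchar2 pcharL2) orbb => /eqP xy1.
  by rewrite -[x](divfK y0) xy1 mul1r.
set r := x / y; have rq: r ^+ q = r^-1.
  have: r * r ^+ q = 1 by rewrite -exprS exprMn exprVn xy divff ?expf_neq0.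
  by move/mulr1_eq.
have frob_iter i : r ^+ (q ^ i)%N = if odd i then r^-1 else r.
  elim: i => [|i IH]; rewrite ?expr1 // expnSr exprM IH /=.
  by case: (odd i); rewrite ?exprVn rq ?invrK.
have r0 : r != 0.
  rewrite mulf_neq0 ?invr_eq0 //; apply: contraNneq y0 => x0.
  by move: xy; rewrite x0 expr0n => /esym/eqP; rewrite expf_eq0.
have := frob_iter (\dim {:L}); rewrite frob_iter_dim odd_dimL => rV.
by rewrite expr2 {2}rV mulfV.
Qed.

Lemma norm_surj y : exists x, x ^+ q.+1 = y.
Proof.
pose N (x : finvect_type L) : finvect_type L := x ^+ q.+1.
by exists (invF (norm_inj : injective N) y); exact: (f_invF (norm_inj : injective N)).
Qed.

(** The F-linear map z^q - z has kernel F, and its image meets F only in 0; rank-nullity makes the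
    two fill L. *)
Lemma artin_schreier_onto y : exists z c, z ^+ q - z + c%:A = y.
Proof.
pose f z := z ^+ q - z.
have f_lin : linear f.
  move=> a x z; rewrite /f frobD frobZ scalerBr.
  by rewrite opprD addrACA.
pose fM := GRing.isLinear.Build _ _ _ _ f f_lin.
pose fL : {linear L -> L} := HB.pack f fM.
pose g := linfun fL.
have gE z : g z = z ^+ q - z by rewrite lfunE.
have kerg : lker g = 1%VS.
  apply/vspaceP=> z; rewrite memv_ker gE subr_eq0.
  by rewrite (Fermat's_little_theorem 1%AS) dimv1 expn1.
have cap0 : (limg g :&: 1 = 0)%VS.
  apply/eqP; rewrite -subv0; apply/subvP=> _ /memv_capP[/memv_imgP[z _ ->] /vlineP[c]].
  by rewrite gE memv0 => /[dup] /artin_schreier_base -> ->; rewrite scale0r.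
have sum_full : (limg g + 1 = fullv)%VS.
  apply/eqP; rewrite eqEdim subvf dimv_disjoint_sum // addnC -kerg.
  by rewrite -[X in (\dim X + _)%N]capfv limg_ker_dim leqnn.
have /memv_addP[_ /memv_imgP[z _ ->] [_ /vlineP[c ->] defy]] : y \in (limg g + 1)%VS.
  by rewrite sum_full memvf.
by exists z, c; rewrite defy gE.
Qed.

Lemma sqrt_pchar2 c : exists a, a ^+ 2 = c.
Proof.
have inj := sqr_inj_pchar2 pcharF2.
by exists (invF inj c); exact: (f_invF inj).
Qed.

(** Writing the second U-component as [x * t] factors out x^(q+1); moreover c^(q+1) = c^2 for c in
    F. *)
Lemma form_infinite x t c :
  form ((x, 0) : V) ((x * t, c) : V) = x ^+ q.+1 * (t ^+ q - t + (c ^+ 2)%:A).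
Proof.
rewrite /form /wronskian /minor /= scale0r mul0r subr0 !scale_in_alg !mulr1.
rewrite expr2 rmorphM /= !exprS !exprMn !frob_in_alg /=.
by move: (in_alg L c) (x ^+ q) (t ^+ q) => *; ring.
Qed.

(** The Wronskian is the cross term of (c^-1 x + c y)^(q+1), where the scalars cancel, and the minor
    supplies (c y)^(q+1); signs vanish in characteristic 2. *)
Lemma form_affine x c y : c != 0 ->
  form ((x, c) : V) ((y, 0) : V)
    = (c^-1 *: x + c *: y) ^+ q.+1 + (c^-1 *: x) ^+ q.+1.
Proof.
move=> c0; rewrite /form /wronskian /minor /= scale0r mulr0 sub0r.
rewrite !scale_in_alg !mulr1 !exprS !(frobD, frobN, exprMn, frob_in_alg).
have cV : in_alg L c * in_alg L c^-1 = 1 by rewrite -rmorphM mulfV ?rmorph1.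
rewrite !(oppr_pchar2 pcharL2).
move: cV; move: (in_alg L c) (in_alg L c^-1) (x ^+ q) (y ^+ q) => g h X Y gh.
transitivity (g * h * (x * Y + X * y) + g * y * (g * Y)); first by rewrite gh mul1r.
apply/eqP; rewrite -subr_eq0; apply/eqP.
transitivity (- ((h * x * (h * X)) *+ 2)); first by ring.
by rewrite (mulrn_pchar pcharL2) oppr0.
Qed.

Lemma form_complete u alpha : u != 0 -> exists v, form u v = alpha.
Proof.
case: u => [x c] u0; have [c0|c0] := eqVneq c 0.
  have x0: x != 0 by apply: contraNneq u0 => x0; rewrite c0 x0.
  have [t [e te]] := artin_schreier_onto (alpha / x ^+ q.+1).
  have [a ae] := sqrt_pchar2 e.
  exists (x * t, a); rewrite c0 form_infinite ae te mulrC divfK //.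
  by rewrite expf_neq0.
have [z zN] := norm_surj (alpha + (c^-1 *: x) ^+ q.+1).
(* This y solves c^-1 x + c y = z. *)
exists (c^-1 *: (z - c^-1 *: x), 0); rewrite form_affine // scalerA mulfV // scale1r.
by rewrite [c^-1 *: x + _]addrC subrK zN -addrA (addrr_pchar2 pcharL2) addr0.
Qed.

Lemma form_complete_unique u v w : u != 0 -> form u v = form u w ->
  w \in <<[:: u; v]>>%VS.
Proof.
case: u => [x c] u0; have [c0|c0] := eqVneq c 0.
  have x0: x != 0 by apply: contraNneq u0 => x0; rewrite c0 x0.
  case: v w => [y a] [z b]; rewrite c0.
  rewrite -[y](mulfVK x0) -[z](mulfVK x0) !(mulrC _ x) !form_infinite.
  move/(mulfI (expf_neq0 _ x0)).
  move: (y / x) (z / x) => s t st.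
  (* The value lies in F, hence is 0: so t - s is in F and a^2 = b^2. *)
  have /[dup] E : (t - s) ^+ q - (t - s) = (a ^+ 2 - b ^+ 2)%:A.
    rewrite !frobE scalerBl; apply/eqP; rewrite -subr_eq0; apply/eqP.
    transitivity (t ^+ q - t + (b ^+ 2)%:A - (s ^+ q - s + (a ^+ 2)%:A)); first by ring.
    by rewrite st subrr.
  case/artin_schreier_const=> e ts; move/artin_schreier_base/eqP: E.
  rewrite subr_eq0 => /eqP/(sqr_inj_pchar2 pcharF2) <-.
  apply/span2P; exists e, 1; rewrite scale1r -[t](subrK s) ts mulrDr.
  by congr (_, _); rewrite /= ?scaler0 ?add0r // mulr_algr.
(* Subtracting a multiple of u moves the second vector into U without changing the form. *)
have norm_form (v' : V) (y := v'.1 - (v'.2 / c) *: x) :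
    v' = (v'.2 / c) *: ((x, c) : V) + ((y, 0) : V).
  case: v' @y => y b /=; congr (_, _); first by rewrite addrC subrK.
  by rewrite addr0 -[LHS](divfK c0).
rewrite [v]norm_form [w]norm_form !form_addr !form_affine // span2_addr.
move/addIr/norm_inj/addrI/(scalerI c0) ->.
by apply/span2P; exists (w.2 / c), 1; rewrite scale1r.
Qed.

Lemma line_set_spread alpha : alpha != 0 -> is_spread (line_set alpha).
Proof.
move=> alpha0; split=> [|p]; first by apply/subsetP=> l; rewrite inE => /andP[].
rewrite inE => dp; set u := vpick p.
have u0: u != 0 by rewrite vpick0 -dimv_eq0 (eqP dp).
have defp : p = <[u]>%VS.
  by apply/esym/eqP; rewrite eqEdim dim_vline u0 (eqP dp) leqnn andbT -memvE memv_pick.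
have [v fuv] := form_complete alpha u0.
apply/eqP/cards1P; exists <<[:: u; v]>>%VS; apply/setP=> l.
rewrite in_set1 in_set defp -memvE.
apply/idP/eqP=> [/andP[lS ul]|->]; last first.
  rewrite memv_span ?mem_head // andbT.
  by apply/(line_setP _ alpha0); exists u, v.
have [w [-> fuw]] := line_set_through alpha0 u0 lS ul.
apply: eq_span2.
- by rewrite dim_form ?fuw.
- by rewrite memv_span ?mem_head.
- by apply: form_complete_unique; rewrite ?fuw.
- by rewrite form_free ?fuv.
Qed.

(** If a and c differed, t^q - t would lie in F, and then so would t. *)
Lemma artin_schreier_indep t a b c d : t \notin 1%VS ->
  a *: (t ^+ q - t) + b%:A = c *: (t ^+ q - t) + d%:A -> a = c /\ b = d.
Proof.
move=> tF E; have [ac|ac] := eqVneq a c.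
  split=> //; move: E; rewrite ac => /addrI/eqP; rewrite -subr_eq0 -scalerBl.
  by rewrite scaler_eq0 oner_eq0 orbF subr_eq0 => /eqP.
suff [e te]: exists e, t = e%:A by rewrite te rpredZ ?mem1v in tF.
apply: (@artin_schreier_const t ((d - b) / (a - c))).
have ac0: a - c != 0 by rewrite subr_eq0.
apply: (scalerI ac0); rewrite scalerA mulrC divfK // !scalerBl.
by apply/eqP; rewrite subr_eq addrAC eq_sym subr_eq eq_sym E addrC.
Qed.

Lemma form_infinite_scale x t c e :
  form ((x, 0) : V) (e *: ((x * t, c) : V))
    = x ^+ q.+1 * (e *: (t ^+ q - t) + ((e * c) ^+ 2)%:A).
Proof.
have -> : e *: ((x * t, c) : V) = (x * (e *: t), e * c) :> V.
  by congr (_, _); rewrite /= scalerAr.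
by rewrite form_infinite frobZ -scalerBr.
Qed.

(** The swap has determinant -d, which is d in characteristic 2. *)
Lemma form_swap d u v : form v (d *: u) = form u (d *: v).
Proof.
have := form_lin 0 1 d 0 u v; rewrite !scale0r scale1r add0r addr0 => ->.
by rewrite form_scale mul0r mul1r sub0r (oppr_pchar2 pcharF2).
Qed.

(** Every line meets U, and from a point x of U the form is x^(q+1) times d (t^q - t) + (d c)^2,
    which determines d by the direct sum. *)
Lemma form_scale_inj u v : free [:: u; v] -> injective (fun d => form u (d *: v)).
Proof.
wlog u2 : u v / u.2 = 0 => [IH fr|fr d e /=].
  have [|u2] := eqVneq u.2 0; first by move=> u2; exact: IH.
  (* Otherwise move to a point of the line in L, using the symmetry of form. *)
  pose g := - (v.2 / u.2).
  have E d : form (g *: u + v) (d *: u) = form u (d *: v).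
    by rewrite [LHS]form_swap scalerDr scalerA form_addr.
  move=> d e /=; rewrite -!E; apply: IH.
    by rewrite /= /g /GRing.scale /= mulNr divfK // addNr.
  rewrite (perm_free (permEl (perm_catC [:: _] [:: u]))) /=.
  by rewrite /free span2_addr (eqnP fr).
case: u v u2 fr => [x c] [y a] /= -> fr.
have x0: x != 0.
  by apply: contraTneq fr => ->; rewrite free_cons mem0v.
rewrite -[y](mulfVK x0) (mulrC _ x) !form_infinite_scale.
move/(mulfI (expf_neq0 _ x0)).
have [/vlineP[b tb]|tF] := boolP (y / x \in 1%VS); last first.
  by case/(artin_schreier_indep tF).
(* When y / x is in F only the w-coordinate [a] of v contributes; it is nonzero because u and v are
   independent. *)
rewrite tb frobA subrr !scaler0 !add0r => /eqP; rewrite -subr_eq0 -scalerBl.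
rewrite scaler_eq0 oner_eq0 orbF subr_eq0 => /eqP/(sqr_inj_pchar2 pcharF2).
apply: mulIf; apply: contraTneq fr => a0; apply/(free2P _).
  by apply: contraNneq x0 => -[->].
by exists b; rewrite -[y](mulfVK x0) tb a0; congr (_, _); rewrite /= ?scaler0 // mulr_algl.
Qed.

Hypothesis dimL_gt1 : (1 < \dim {:L})%N.

(** The family is a set, so coincidences among the B_alpha would lower the count of spreads through
    a line; this excludes them. *)
Lemma line_set_inj alpha beta :
  alpha != 0 -> beta != 0 -> line_set alpha = line_set beta -> alpha = beta.
Proof.
move=> alpha0 beta0 eqS.
have /subvPn[t _ tF]: ~~ ({:L} <= 1)%VS.
  by apply: contraTN dimL_gt1 => /dimvS; rewrite dimv1 -leqNgt.
have gamma0 c : t ^+ q - t + c%:A != 0.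
  apply/eqP => E; have := @artin_schreier_indep t 1 c 0 0 tF.
  by rewrite scale1r !scale0r addr0 E => /(_ erefl)[/eqP]; rewrite oner_eq0.
(* Compare B_alpha and B_beta on a line with c = 0, then on one with c = 1. *)
have step c : exists2 d, d != 0 &
    beta * (t ^+ q - t + (c ^+ 2)%:A) = alpha * (d *: (t ^+ q - t) + ((d * c) ^+ 2)%:A).
  (* This x gives the form the value alpha on the chosen basis. *)
  have [x Nx] := norm_surj (alpha / (t ^+ q - t + (c ^+ 2)%:A)).
  have fuv : form ((x, 0) : V) ((x * t, c) : V) = alpha.
    by rewrite form_infinite Nx divfK.
  have fr : free [:: (x, 0) : V; (x * t, c) : V] by rewrite form_free ?fuv.
  have [|d d0 fd] := mem_line_set_span beta0 fr.
    by rewrite -eqS; apply/(line_setP _ alpha0); exists (x, 0), (x * t, c).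
  exists d => //; move: fd; rewrite form_infinite_scale Nx => <-.
  by rewrite mulrAC divfK.
(* The case c = 0 gives beta = d alpha; the case c = 1 then gives e = d and e^2 = d, so d = 1. *)
have [d d0] := step 0; rewrite mulr0 expr0n scale0r !addr0.
have [e e0] := step 1; rewrite mulr1 expr1n => E1.
have {}gamma0 : t ^+ q - t != 0 by have := gamma0 0; rewrite scale0r addr0.
rewrite -scalerAr scalerAl => /(mulIf gamma0) defb; move: E1.
rewrite defb -scalerAl scalerAr => /(mulfI alpha0); rewrite scalerDr scalerA mulr1.
case/(artin_schreier_indep tF) => <- /eqP; rewrite expr2 -{1}[d]mulr1 => /eqP/(mulfI d0) <-.
by rewrite scale1r.
Qed.

(** The spreads through l correspond bijectively to the nonzero scalars d, through the values
    [form u (d *: v)]. *)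
Lemma line_count l : l \in lines V ->
  #|[set S in line_set_family L | l \in S]| = q.-1.
Proof.
rewrite inE => /eqP dl; have [u lu u0]: exists2 u, u \in l & u != 0.
  by exists (vpick l); rewrite ?memv_pick // vpick0 -dimv_eq0 dl.
have [v [fr defl]] := line_through dl lu u0.
have form0 d : d != 0 -> form u (d *: v) != 0.
  apply: contraNneq => f0; apply/eqP/(form_scale_inj fr) => /=.
  by rewrite f0 form_scale scale0r expr0n !mul0r addr0.
rewrite -(cardsC1 (0 : F)) -(card_in_imset (f := fun d => line_set (form u (d *: v)))).
  congr #|pred_of_set _|; apply/setP=> S; rewrite in_set.
  apply/andP/imsetP=> [[/imsetP[alpha]]|[d]].
    rewrite inE => alpha0 ->; rewrite defl => /(mem_line_set_span alpha0 fr)[d d0 fd].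
    by exists d; [rewrite in_setC1 | rewrite -fd].
  rewrite in_setC1 => d0 ->; split.
    by apply: (imset_f (fun x : finvect_type L => line_set x)); rewrite inE; exact: form0.
  by rewrite defl; exact: (span_mem_line_set (form0 d d0) d0 erefl).
move=> d e; rewrite !in_setC1 => d0 e0 /line_set_inj E.
by apply: (form_scale_inj fr); apply: E; apply: form0.
Qed.

End LineSets.

(** * Transitivity through homotheties of U *)

Section Homothety.
Variables (F : finFieldType) (L : fieldExtType F).
Local Notation q := #|F|.
Local Notation V := (ambient L).
Implicit Types (alpha lam : L) (u v : V) (l : {vspace V}).

Definition homothety lam (v : finvect_type V) : finvect_type V := (lam * v.1, v.2).

Lemma homothetyK lam : lam != 0 -> cancel (homothety lam) (homothety lam^-1).
Proof. by move=> lam0 [x c]; rewrite /homothety mulKf. Qed.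

Lemma homothety_lin lam a b u v :
  homothety lam (a *: u + b *: v) = a *: homothety lam u + b *: homothety lam v.
Proof. by congr (_, _); rewrite /= mulrDr -!scalerAr. Qed.

(** The Wronskian scales by lam^(q+1) and the minor by lam, so both terms of the form scale
    alike. *)
Lemma form_homothety lam u v :
  form (homothety lam u) (homothety lam v) = lam ^+ q.+1 * form u v.
Proof.
rewrite /form /wronskian /minor /= !exprS !(frobD, frobN, exprMn, scale_in_alg).
by move: (_ ^+ _) (in_alg L u.2) (in_alg L v.2) => *; ring.
Qed.

Variables (lam : L) (lam0 : lam != 0).

Definition homothety_perm : {perm finvect_type V} := perm (can_inj (homothetyK lam0)).

Lemma homothety_permE v : homothety_perm v = homothety lam v.
Proof. by rewrite permE. Qed.

Lemma homothety_GammaL : homothety_perm \in GammaL V.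
Proof.
rewrite inE; apply/existsP; exists 1%g; apply/andP; split.
  by apply/field_autoP; split=> [|a b|a b]; rewrite !perm1.
apply/semilinear_forP; split=> [u v|a v]; rewrite !homothety_permE.
  by have := homothety_lin lam 1 1 u v; rewrite !scale1r.
by have := homothety_lin lam a 0 v v; rewrite perm1 !scale0r !addr0.
Qed.

Lemma vsact_homothety u v :
  vsact <<[:: u; v]>> homothety_perm = <<[:: homothety lam u; homothety lam v]>>%VS.
Proof.
apply/vspaceP=> w; rewrite -[w](permKV homothety_perm).
rewrite memv_vsact ?homothety_GammaL //; set w' := _ w.
apply/span2P/span2P=> -[a [b defw]]; exists a, b.
  by rewrite homothety_permE defw homothety_lin.
apply: (can_inj (homothetyK lam0)); rewrite -homothety_permE defw.
by rewrite homothety_lin.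
Qed.

Lemma homothety_line_set alpha : alpha != 0 ->
  (pgact V)^*%act (line_set alpha) (coset (scalars V) homothety_perm)
    = line_set (lam ^+ q.+1 * alpha).
Proof.
move=> alpha0; have beta0: lam ^+ q.+1 * alpha != 0 by rewrite mulf_neq0 ?expf_neq0.
have lamV x : lam^-1 != 0 -> homothety lam (homothety lam^-1 x) = x.
  by move/homothetyK/(_ x); rewrite invrK.
apply/setP=> l; apply/imsetP/(line_setP _ beta0).
  case=> _ /(line_setP _ alpha0)[u [v [-> fuv]]] ->.
  exists (homothety lam u), (homothety lam v).
  by rewrite pgactE ?homothety_GammaL // vsact_homothety form_homothety fuv.
case=> u [v [-> fuv]]; pose u' := homothety lam^-1 u; pose v' := homothety lam^-1 v.
exists <<[:: u'; v']>>%VS; last first.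
  by rewrite pgactE ?homothety_GammaL // vsact_homothety !lamV ?invr_neq0.
apply/(line_setP _ alpha0); exists u', v'; split=> //.
by rewrite form_homothety fuv exprVn mulKf ?expf_neq0.
Qed.

End Homothety.

(** The group is the full stabiliser of the family, so invariance is automatic; it contains the
    homotheties, which carry B_1 to every B_alpha because lam^(q+1) takes every value. *)
Lemma line_sets_transitive (F : finFieldType) (L : fieldExtType F) :
  2%N \in [pchar F] -> odd (\dim {:L}) ->
  exists G : {group coset_of (scalars (ambient L))},
    [/\ G \subset PGammaL (ambient L),
        [acts G, on line_set_family L | (pgact (ambient L))^*]
      & [transitive G, on line_set_family L | (pgact (ambient L))^*]].
Proof.
move=> pcharF2 odd_dimL; pose P := line_set_family L.
pose to := (pgact (ambient L))^*%act.
have sGD : 'N(P | to)%g \subset PGammaL (ambient L) by rewrite subsetIl.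
exists [group of 'N(P | to)%g]; split=> //.
pose a lam (lam0 : lam != 0 :> L) := coset (scalars _) (homothety_perm lam0).
have Da lam lam0 : @a lam lam0 \in PGammaL (ambient L).
  by rewrite mem_quotient ?homothety_GammaL.
have Na lam lam0 : @a lam lam0 \in 'N(P | to)%g.
  rewrite inE Da inE; apply/subsetP=> _ /imsetP[alpha alpha0 ->]; rewrite inE in alpha0.
  rewrite inE /to /a homothety_line_set //.
  apply: (imset_f (fun x : finvect_type L => line_set x)).
  by rewrite inE; apply: mulf_neq0; rewrite ?expf_neq0.
apply/imsetP; exists (line_set 1).
  by apply: (imset_f (fun x : finvect_type L => line_set x)); rewrite inE; exact: oner_neq0.
apply/setP=> S; apply/idP/imsetP=> [/imsetP[alpha alpha0 ->]|[g Ng ->]].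
  rewrite inE in alpha0; have [lam Nlam] := norm_surj pcharF2 odd_dimL alpha.
  have lam0 : lam != 0 by apply: contraNneq alpha0 => lam0; rewrite -Nlam lam0 expr0n.
  by exists (a lam lam0); rewrite // /to /a homothety_line_set ?oner_neq0 // Nlam mulr1.
rewrite (astabs_act _ Ng).
by apply: (imset_f (fun x : finvect_type L => line_set x)); rewrite inE; exact: oner_neq0.
Qed.

Local Close Scope ring_scope.

Theorem theorem1p1 (n k : nat) (F : finFieldType) (L : fieldExtType F)
    (odd_n : odd n) (n_ge3 : 3 <= n) (odd_k : odd k)
    (cardF : #|F| = 2 ^ k) (dimL : \dim {:L} = n) :
  is_transitive_packing (2 ^ k - 1) (line_set_family L).
Proof.
have pcharF2 := card_finPcharP cardF (isT : prime 2).
rewrite -dimL in odd_n n_ge3; split; last exact: line_sets_transitive.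
split=> [_ /imsetP[alpha alpha0 ->]|l ll].
  by rewrite inE in alpha0; exact: line_set_spread.
by rewrite line_count ?cardF ?subn1 // ltnW.
Qed.
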